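(* Let $W$ be a set, $\mathcal{S}$ a collection of subsets of $W$ (the stereotypes), $D$ a partially ordered set, and $d$ a function assigning to each $F \subseteq W$ and each $S \in \mathcal{S}$ an element $d(F,S) \in D$. Assume: (i) for every $F \subseteq W$ there exists a unique stereotype, denoted $S^{F} \in \mathcal{S}$, such that $d(F,S^{F}) \leq d(F,S)$ for every $S \in \mathcal{S}$; (ii) for all $F, F' \subseteq W$ and all $S, S' \in \mathcal{S}$, if $F' \cap S' \subseteq F \cap S$ and $S - F \subseteq S' - F'$, then $d(F,S) \leq d(F',S')$. Then for all $F, F' \subseteq W$ with $F \cap S^{F} \subseteq F' \subseteq F$, one has $S^{F'} = S^{F}$.
   Context: $W$ is thought of as the set of all possible states of affairs (models), subsets $F \subseteq W$ as information sets, and $d(F,S)$ as the distance from the information set $F$ to the stereotype $S$. The notation $S - F$ denotes set difference. $S^{F}$ is the stereotype closest to $F$. *)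

(* Defs.v *)
From mathcomp Require Import all_boot all_order.
From mathcomp Require Import boolp classical_sets.

Set Implicit Arguments.
Unset Strict Implicit.
Unset Printing Implicit Defensive.

Local Open Scope classical_set_scope.
Local Open Scope order_scope.

(** A collection [SS : set (set W)] coerces to the type of its members, so
    [S : SS] is a stereotype and [val S : set W] its underlying subset;
    the distance is thus defined on stereotypes only. *)

Definition closest (W : Type) (SS : set (set W)) (disp : Order.disp_t)
    (D : porderType disp) (d : set W -> SS -> D) (F : set W) (S : SS) : Prop :=
  forall S' : SS, d F S <= d F S'.

(** [closest_stereotype ex_closest F] is the stereotype $S^F$. *)
Definition closest_stereotype (W : Type) (SS : set (set W))
    (disp : Order.disp_t) (D : porderType disp) (d : set W -> SS -> D)
    (ex_closest : forall F : set W, exists! S : SS, closest d F S)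
    (F : set W) : SS :=
  sval (cid (ex_closest F)).

(* Main.v *)
(** Passing from [F] to a subset [F'] can only increase the distance to any
    stereotype, and since [F'] keeps all of [F `&` S^F], the distance to [S^F]
    does not increase:
    [d F' S^F <= d F S^F <= d F T <= d F' T] for every stereotype [T]. *)

Require Import Defs.
From mathcomp Require Import all_boot all_order.
From mathcomp Require Import boolp classical_sets.

Set Implicit Arguments.
Unset Strict Implicit.
Unset Printing Implicit Defensive.

Local Open Scope classical_set_scope.
Local Open Scope order_scope.

Theorem theorem1 (W : Type) (SS : set (set W)) (disp : Order.disp_t)
    (D : porderType disp) (d : set W -> SS -> D)
    (ex_closest : forall F : set W, exists! S : SS, closest d F S)
    (d_mono : forall (F F' : set W) (S S' : SS),
       F' `&` val S' `<=` F `&` val S ->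
       val S `\` F `<=` val S' `\` F' ->
       d F S <= d F' S') :
  forall F F' : set W,
    F `&` val (closest_stereotype ex_closest F) `<=` F' ->
    F' `<=` F ->
    closest_stereotype ex_closest F' = closest_stereotype ex_closest F.
Proof.
move=> F F' FSF' F'F; rewrite /closest_stereotype in FSF' *.
case: (cid (ex_closest F)) FSF' => S [/= S_min _] FSF'.
case: (cid (ex_closest F')) => S' [/= _ S'_uniq].
(* Uniqueness of the stereotype closest to [F'] reduces [S' = S] to the minimality of [S] for [F']:
   [d F' S <= d F' T] for all [T]. *)
apply: S'_uniq => T.
have dF'F : d F' S <= d F S.
  apply: d_mono => x [].
    by move=> Fx Sx; split=> //; apply: FSF'.
  (* A point of [S] outside [F'] is outside [F], since [F'] contains all of [F] within [S]. *)
  by move=> Sx nF'x; split=> // Fx; apply/nF'x/FSF'.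
apply: (Order.POrderTheory.le_trans dF'F).
apply: (Order.POrderTheory.le_trans (S_min T)).
(* What remains is [d F T <= d F' T]; both inclusions come from [F'F], the second by
   contraposition. *)
by apply: d_mono => x [] ? ?; split; auto.
Qed.
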